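(* Every matroid of rank three is Rayleigh.
   Context: Let $\mathcal{M}$ be a matroid on a finite ground set $E$, and let $\mathbf{y}=\{y_c : c\in E\}$ be indeterminates. For a basis $B$ write $\mathbf{y}^B=\prod_{e\in B}y_e$ and let $M(\mathbf{y})=\sum_{B}\mathbf{y}^B$, summed over all bases $B$ of $\mathcal{M}$. For disjoint $I,J\subseteq E$ let $\mathcal{M}_I^J=\{B\setminus I : B \text{ a basis of } \mathcal{M},\ I\subseteq B\subseteq E\setminus J\}$ (so it is empty if $I$ is dependent), and $M_I^J(\mathbf{y})=\sum_{A\in\mathcal{M}_I^J}\mathbf{y}^A$ (subscripts/superscripts listing elements, e.g. $M_e^f=M_{\{e\}}^{\{f\}}$, $M_{ef}=M_{\{e,f\}}^{\emptyset}$, $M^{ef}=M_{\emptyset}^{\{e,f\}}$). For distinct $e,f\in E$ define $\Delta M\{e,f\}(\mathbf{y})=M_e^f(\mathbf{y})M_f^e(\mathbf{y})-M_{ef}(\mathbf{y})M^{ef}(\mathbf{y})$. The matroid $\mathcal{M}$ is called Rayleigh if for every choice of real numbers $y_c>0$ ($c\in E$) and every pair of distinct $e,f\in E$, $\Delta M\{e,f\}(\mathbf{y})\ge 0$. *)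

(* Defs.v *)
From mathcomp Require Import all_boot all_order all_algebra.
From mathcomp Require Import reals.

Set Implicit Arguments.
Unset Strict Implicit.
Unset Printing Implicit Defensive.

Import GRing.Theory Num.Theory.
Local Open Scope ring_scope.

Record matroid (E : finType) := Matroid {
  bases : {set {set E}};
  bases_neq0 : bases != set0;
  bases_exchange : forall A B : {set E}, A \in bases -> B \in bases ->
    forall a : E, a \in A :\: B ->
    exists2 b : E, b \in B :\: A & b |: (A :\ a) \in bases
}.

Definition rank (E : finType) (M : matroid E) : nat :=
  (\max_(B in bases M) #|B|)%N.

(* The maximum above is the common cardinality of the bases. *)
Lemma card_bases_leq (E : finType) (M : matroid E) (A B : {set E}) :
  A \in bases M -> B \in bases M -> (#|A| <= #|B|)%N.
Proof.
have [n] := ubnP #|A :\: B|; elim: n A => // n IHn A ltn MA MB.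
have [/eqP | [a aAB]] := set_0Vmem (A :\: B).
  by rewrite setD_eq0; exact: subset_leq_card.
have [b] := bases_exchange MA MB aAB; move: (aAB).
rewrite !inE => /andP[_ aA] /andP[bNA bB] MC.
suff cardAb : #|b |: (A :\ a)| = #|A|.
  rewrite -cardAb; apply: IHn => //; rewrite ltnS in ltn; apply: (leq_trans _ ltn).
  apply: proper_card; apply/properP; split.
    apply/subsetP=> x; rewrite !inE.
    by case: eqP => [->|_] /=; [rewrite bB | case/and3P=> -> _ ->].
  exists a => //; rewrite !inE eqxx /= orbF.
  by apply/negP => /andP[_ /eqP eab]; rewrite -eab aA in bNA.
by rewrite cardsU1 !inE (negPf bNA) andbF (cardsD1 a A) aA.
Qed.

Lemma card_basis (E : finType) (M : matroid E) (B : {set E}) :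
  B \in bases M -> #|B| = rank M.
Proof.
move=> MB; apply/eqP; rewrite eqn_leq leq_bigmax_cond //=.
by apply/bigmax_leqP => A MA; exact: card_bases_leq MA MB.
Qed.

(* [minor M I J] is M_I^J (contract I, delete J), for disjoint I and J. *)
Definition minor (E : finType) (M : matroid E) (I J : {set E}) :
    {set {set E}} :=
  [set B :\: I | B in bases M & (I \subset B) && (B \subset ~: J)].

(* The polynomial M_I^J(y), given by its value at any point of any commutative
   ring. *)
Definition minor_poly (R : comNzRingType) (E : finType) (M : matroid E)
    (I J : {set E}) (y : E -> R) : R :=
  \sum_(A in minor M I J) \prod_(c in A) y c.

Definition rayleigh_diff (R : comNzRingType) (E : finType) (M : matroid E)
    (e f : E) (y : E -> R) : R :=
  minor_poly M [set e] [set f] y * minor_poly M [set f] [set e] y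
  - minor_poly M [set e; f] set0 y * minor_poly M set0 [set e; f] y.

Definition rayleigh (R : realType) (E : finType) (M : matroid E) : Prop :=
  forall y : E -> R, (forall c : E, 0 < y c) ->
  forall e f : E, e != f -> 0 <= rayleigh_diff M e f y.

(* Main.v *)
(** Give [e] and [f] weight zero and let [X] be the total weight of the points
    off the line [ef].  These points lie in a grid whose rows are the lines
    through [e] and whose columns are the lines through [f]; let [x_ij], [r_i],
    [c_j] be the weights of the cells, rows and columns, [R] and [C] the second
    elementary symmetric functions of the [r_i] and of the [c_j], and [T] the
    sum over the bases off the line.  The contribution of the points on the line
    [ef] is nonnegative term by term, which leaves [R C >= X T].  A basis off the
    line has its points in three distinct cells, not all in one row and not all
    in one column.  If [T'] is the sum over all such triples and [N] the sum over
    the triples with distinct rows and distinct columns, then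
      [R C - X T' = 1/4 \sum_(i, j) (x_ij X - r_i c_j)^2 + 1/2 X N]. *)

Require Import Defs.
From mathcomp Require Import all_boot all_order all_algebra.
From mathcomp Require Import reals.
From mathcomp Require Import ring lra.

Set Implicit Arguments.
Unset Strict Implicit.
Unset Printing Implicit Defensive.

Import Order.TTheory GRing.Theory Num.Theory.
Local Open Scope ring_scope.

(** * Rank-three bases as ordered triples *)

(** In rank three a triple with a repeated point is never a basis, so sums may run over all ordered
    triples. *)
Definition basis3 (E : finType) (M : matroid E) (a b c : E) : bool :=
  [set a; b; c] \in bases M.

Lemma basis3C12 (E : finType) (M : matroid E) a b c :
  basis3 M a b c = basis3 M b a c.
Proof. by rewrite /basis3 [[set a; b]]setUC. Qed.

Lemma basis3C23 (E : finType) (M : matroid E) a b c :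
  basis3 M a b c = basis3 M a c b.
Proof. by rewrite /basis3 -setUA [[set b; c]]setUC setUA. Qed.

Lemma basis3_diag (E : finType) (M : matroid E) a c :
  rank M = 3%N -> basis3 M a a c = false.
Proof.
move=> rk; apply/negP => /card_basis; rewrite rk setUid cards2.
by case: (a != c).
Qed.

Lemma basis3_diag13 (E : finType) (M : matroid E) a c :
  rank M = 3%N -> basis3 M a c a = false.
Proof. by move=> rk; rewrite basis3C23 basis3_diag. Qed.

Lemma basis3_diag23 (E : finType) (M : matroid E) a c :
  rank M = 3%N -> basis3 M a c c = false.
Proof. by move=> rk; rewrite basis3C12 basis3_diag13. Qed.

Lemma basis3_exchange (E : finType) (M : matroid E) a b c d g h :
  rank M = 3%N -> basis3 M a b c -> basis3 M d g h ->
  [|| basis3 M d b c, basis3 M g b c | basis3 M h b c].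
Proof.
move=> rk Kabc Kdgh.
have [aB|aNB] := boolP (a \in [set d; g; h]).
  by move: aB; rewrite !inE => /orP[/orP[]|] /eqP <-; rewrite Kabc ?orbT.
have aAB : a \in [set a; b; c] :\: [set d; g; h] by rewrite inE aNB !inE eqxx.
have [x xBA] := bases_exchange Kabc Kdgh aAB.
have -> : [set a; b; c] :\ a = [set b; c].
  have ab : a != b.
    by apply: contraTneq Kabc => ->; rewrite basis3_diag.
  have ac : a != c.
    by apply: contraTneq Kabc => ->; rewrite basis3C23 basis3_diag.
  by rewrite -setUA setU1K // !inE negb_or ab ac.
rewrite setUA => Kx; move: xBA; rewrite !inE => /andP[_].
by case/orP=> [/orP[]|] /eqP <-; rewrite [basis3 M x b c]Kx ?orbT.
Qed.

(** * Contractions as linear, quadratic and cubic forms *)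

Definition form2 (R : comNzRingType) (E : finType) (k : E -> E -> R)
    (u v : E -> R) : R :=
  \sum_a \sum_b u a * v b * k a b.

Definition form3 (R : comNzRingType) (E : finType) (k : E -> E -> E -> R)
    (u v w : E -> R) : R :=
  \sum_a \sum_b \sum_c u a * v b * w c * k a b c.

(** The partial derivative of [M(y)] in the elements of [I]; deletion is left to zero weights. *)
Definition link_poly (R : comNzRingType) (E : finType) (M : matroid E)
    (I : {set E}) (y : E -> R) : R :=
  \sum_(B in bases M | I \subset B) \prod_(c in B :\: I) y c.

(** A basis through [I] that meets [J] keeps, by disjointness, an element of [J] outside [I], and
    its zero weight kills the term. *)
Lemma minor_poly_link (R : comNzRingType) (E : finType) (M : matroid E)
    (I J : {set E}) (y z : E -> R) :
  (forall c, c \in J -> z c = 0) -> (forall c, c \notin I :|: J -> z c = y c) ->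
  [disjoint I & J] -> minor_poly M I J y = link_poly M I z.
Proof.
move=> z0 zy dIJ; rewrite /minor_poly /minor big_imset /=; last first.
  move=> A B; rewrite !inE => /and3P[_ IA _] /and3P[_ IB _] AB.
  by rewrite -(setID A I) -(setID B I) AB (setIidPr IA) (setIidPr IB).
rewrite /link_poly [RHS](bigID (fun B : {set E} => B \subset ~: J)) /=.
rewrite [X in _ = _ + X]big1 ?addr0; last first.
  move=> B /andP[/andP[_ IB] /subsetPn[c cB]]; rewrite inE negbK => cJ.
  rewrite (bigD1 c) /= ?z0 ?mul0r // inE cB andbT.
  by rewrite (disjointFl dIJ cJ).
apply: eq_big => [B|B]; first by rewrite inE andbA.
rewrite !inE => /and3P[_ _ /subsetP BJ]; apply: eq_bigr => c.
rewrite inE => /andP[cI cB]; rewrite zy // inE negb_or cI.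
by have := BJ c cB; rewrite inE.
Qed.

(* Euler's identity for the homogeneous polynomial [link_poly M I]. *)
Lemma link_poly_euler (R : comNzRingType) (E : finType) (M : matroid E)
    (I : {set E}) (y : E -> R) :
  (rank M - #|I|)%:R * link_poly M I y
  = \sum_(a | a \notin I) y a * link_poly M (a |: I) y.
Proof.
rewrite /link_poly.
under [RHS]eq_bigr => a _ do rewrite big_distrr /=.
rewrite (exchange_big_dep (fun B : {set E} => (B \in bases M) && (I \subset B)))  /=; last first.
  by move=> a B _; rewrite subUset => /and3P[-> _ ->].
rewrite big_distrr; apply: eq_bigr => B /andP[MB IB] /=.
transitivity (\sum_(a in B :\: I) \prod_(c in B :\: I) y c).
  by rewrite sumr_const -(card_basis MB) cardsDS // mulr_natl.
apply: eq_big => [a|a aBI].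
  by rewrite inE MB subUset IB sub1set /= andbT.
rewrite (bigD1 a) //=; congr (_ * _); apply: eq_bigl => c.
by rewrite !inE negb_or andbC andbA.
Qed.

Lemma link_poly_basis (R : comNzRingType) (E : finType) (M : matroid E)
    (I : {set E}) (y : E -> R) :
  #|I| = rank M -> link_poly M I y = (I \in bases M)%:R.
Proof.
move=> cI.
have eqI B : (B \in bases M) && (I \subset B) = (B == I) && (I \in bases M).
  apply/andP/andP => [[MB IB]|[/eqP-> MI]]; last by split.
  have /eqP eIB : I == B by rewrite eqEcard IB (card_basis MB) cI leqnn.
  by rewrite eIB eqxx.
rewrite /link_poly (eq_bigl _ _ eqI).
case: (I \in bases M); last by rewrite big_pred0 // => B; rewrite andbF.
rewrite (eq_bigl (pred1 I)) => [|B]; last by rewrite /= andbT.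
by rewrite big_pred1_eq setDv big_set0.
Qed.

Lemma link_poly2 (R : comNzRingType) (E : finType) (M : matroid E)
    (a b : E) (y : E -> R) :
  rank M = 3%N -> a != b ->
  link_poly M [set a; b] y = \sum_c y c * (basis3 M a b c)%:R.
Proof.
move=> rk ab; have := link_poly_euler M [set a; b] y.
rewrite rk cards2 ab mul1r => ->.
rewrite [RHS](bigID (mem [set a; b])) /= [X in _ = X + _]big1 ?add0r.
  apply: eq_bigr => c cab; rewrite link_poly_basis /basis3 1?setUC //.
  by rewrite setUC cardsU1 cab cards2 ab rk.
move=> c; rewrite !inE => /orP[] /eqP ->.
  by rewrite basis3C23 basis3_diag ?mulr0.
by rewrite basis3C12 basis3C23 basis3_diag ?mulr0.
Qed.

(** The factors 2 here and 6 in [link_poly0] count the orders of the uncontracted points of a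
    basis. *)
Lemma link_poly1 (R : comNzRingType) (E : finType) (M : matroid E)
    (a : E) (y : E -> R) :
  rank M = 3%N ->
  2%:R * link_poly M [set a] y = form2 (fun b c => (basis3 M a b c)%:R) y y.
Proof.
move=> rk; have := link_poly_euler M [set a] y; rewrite rk cards1 => ->.
rewrite /form2 [RHS](bigD1 a) //= [X in _ = X + _]big1 => [|c _]; last first.
  by rewrite basis3_diag ?mulr0.
rewrite add0r; apply: eq_big => [b|b]; rewrite inE // => ba.
rewrite setUC link_poly2 1?eq_sym // big_distrr.
by apply: eq_bigr => c _ /=; rewrite mulrA.
Qed.

Lemma link_poly0 (R : comNzRingType) (E : finType) (M : matroid E)
    (y : E -> R) :
  rank M = 3%N ->
  6%:R * link_poly M set0 y = form3 (fun a b c => (basis3 M a b c)%:R) y y y.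
Proof.
move=> rk; have := link_poly_euler M set0 y; rewrite rk cards0 subn0 => e3.
rewrite (natrM _ 2 3) -mulrA e3 big_distrr; apply: eq_big => [a|a _].
  by rewrite inE.
rewrite /= setU0 mulrCA link_poly1 // big_distrr; apply: eq_bigr => b _ /=.
by rewrite big_distrr; apply: eq_bigr => c _ /=; rewrite !mulrA.
Qed.

(** * Polarization and comparison of forms *)

Lemma form2_split (R : comNzRingType) (E : finType) (k : E -> E -> R)
    (u v : E -> R) :
  (forall a b, k a b = k b a) ->
  form2 k (u \+ v) (u \+ v) = form2 k u u + 2%:R * form2 k u v + form2 k v v.
Proof.
move=> kC; have vu : form2 k v u = form2 k u v.
  rewrite /form2 exchange_big; apply: eq_bigr => a _; apply: eq_bigr => b _.
  by rewrite kC [v b * _]mulrC.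
rewrite mulr_natl mulr2n -{2}vu /form2 -!big_split; apply: eq_bigr => a _ /=.
by rewrite -!big_split; apply: eq_bigr => b _ /=; ring.
Qed.

Lemma form3_swap12 (R : comNzRingType) (E : finType) (k : E -> E -> E -> R)
    (u v w : E -> R) :
  form3 (fun a b c => k b a c) u v w = form3 k v u w.
Proof.
rewrite /form3 exchange_big; apply: eq_bigr => a _; apply: eq_bigr => b _.
by apply: eq_bigr => c _; rewrite [u b * _]mulrC.
Qed.

Lemma form3_swap23 (R : comNzRingType) (E : finType) (k : E -> E -> E -> R)
    (u v w : E -> R) :
  form3 (fun a b c => k a c b) u v w = form3 k u w v.
Proof.
apply: eq_bigr => a _; rewrite exchange_big; apply: eq_bigr => b _.
by apply: eq_bigr => c _; rewrite [_ * v c * _]mulrAC.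
Qed.

Lemma eq_form3 (R : comNzRingType) (E : finType) (k k' : E -> E -> E -> R)
    (u v w : E -> R) :
  (forall a b c, k a b c = k' a b c) -> form3 k u v w = form3 k' u v w.
Proof.
by move=> kk'; do 3!apply: eq_bigr => ? _; rewrite kk'.
Qed.

Lemma form3D (R : comNzRingType) (E : finType) (k k' : E -> E -> E -> R)
    (u v w : E -> R) :
  form3 (fun a b c => k a b c + k' a b c) u v w
  = form3 k u v w + form3 k' u v w.
Proof.
by rewrite /form3; do 3!(rewrite -big_split; apply: eq_bigr => ? _ /=); rewrite mulrDr.
Qed.

Lemma form3Z (R : comNzRingType) (E : finType) (x : R) (k : E -> E -> E -> R)
    (u v w : E -> R) :
  form3 (fun a b c => x * k a b c) u v w = x * form3 k u v w.
Proof.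
by rewrite /form3; do 3!(rewrite mulr_sumr; apply: eq_bigr => ? _ /=); rewrite mulrCA.
Qed.

Lemma form3_split (R : comNzRingType) (E : finType) (k : E -> E -> E -> R)
    (u v : E -> R) :
  (forall a b c, k a b c = k b a c) -> (forall a b c, k a b c = k a c b) ->
  form3 k (u \+ v) (u \+ v) (u \+ v)
  = form3 k u u u + 3%:R * form3 k u u v + 3%:R * form3 k u v v + form3 k v v v.
Proof.
move=> k12 k23.
have s12 x y z : form3 k x y z = form3 k y x z.
  by rewrite -form3_swap12; apply: eq_form3.
have s23 x y z : form3 k x y z = form3 k x z y.
  by rewrite -form3_swap23; apply: eq_form3.
have -> : 3%:R * form3 k u u v = form3 k u u v + form3 k u v u + form3 k v u u.
  by rewrite (s12 v) (s23 u v u); ring.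
have -> : 3%:R * form3 k u v v = form3 k u v v + form3 k v u v + form3 k v v u.
  by rewrite (s23 v v u) (s12 v u v); ring.
by rewrite /form3; do 3!(rewrite -?big_split; apply: eq_bigr => ? _ /=); ring.
Qed.

(** Lets exchange arguments on single triples in the supports bound whole polynomials. *)
Lemma ler_form3 (R : realFieldType) (E : finType) (k k' : E -> E -> E -> R)
    (u v w : E -> R) :
  (forall a, 0 <= u a) -> (forall a, 0 <= v a) -> (forall a, 0 <= w a) ->
  (forall a b c, u a != 0 -> v b != 0 -> w c != 0 -> k a b c <= k' a b c) ->
  form3 k u v w <= form3 k' u v w.
Proof.
move=> u0 v0 w0 kk'; apply: ler_sum => a _; apply: ler_sum => b _.
apply: ler_sum => c _.
have [->|ua] := eqVneq (u a) 0; first by rewrite !mul0r.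
have [->|vb] := eqVneq (v b) 0; first by rewrite mulr0 !mul0r.
have [->|wc] := eqVneq (w c) 0; first by rewrite mulr0 !mul0r.
by apply: ler_wpM2l (kk' _ _ _ ua vb wc); rewrite !mulr_ge0.
Qed.

Lemma form3_sep (R : comNzRingType) (E : finType) (p q : E -> R)
    (u v w : E -> R) :
  form3 (fun a b c => p a * q b) u v w
  = (\sum_a u a * p a) * (\sum_a v a * q a) * \sum_a w a.
Proof.
rewrite /form3 !mulr_suml; apply: eq_bigr => a _.
rewrite mulr_sumr mulr_suml; apply: eq_bigr => b _.
by rewrite mulr_sumr; apply: eq_bigr => c _; ring.
Qed.

Lemma form3_sep2 (R : comNzRingType) (E : finType) (p : E -> R)
    (k : E -> E -> R) (u v w : E -> R) :
  form3 (fun a b c => p a * k b c) u v w = (\sum_a u a * p a) * form2 k v w.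
Proof.
rewrite /form3 !mulr_suml; apply: eq_bigr => a _.
rewrite mulr_sumr; apply: eq_bigr => b _.
by rewrite mulr_sumr; apply: eq_bigr => c _; ring.
Qed.

(** * The grid inequality and symmetrization *)

Lemma sum_fiber (R : comNzRingType) (E I : finType) (f : E -> I) (w : E -> R)
    (F : I -> R) :
  \sum_i (\sum_a w a * (f a == i)%:R) * F i = \sum_a w a * F (f a).
Proof.
under eq_bigr => i _ do rewrite mulr_suml.
rewrite exchange_big; apply: eq_bigr => a _.
rewrite (bigD1 (f a)) //= eqxx mulr1 big1 ?addr0 // => i /negbTE ia.
by rewrite eq_sym ia mulr0 mul0r.
Qed.

(* Expansion of [\sum_(i, j) (x_ij X - r_i c_j)^2 >= 0], where [x_ij] is the
   weight of the cell [(i, j)], [r_i] and [c_j] are the weights of the rows and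
   columns, and [X] is the total weight. *)
Lemma grid_ineq (R : realFieldType) (E I J : finType) (row : E -> I)
    (col : E -> J) (w : E -> R) (X := \sum_a w a)
    (r := fun a => \sum_b w b * (row b == row a)%:R)
    (c := fun a => \sum_b w b * (col b == col a)%:R)
    (x := fun a => \sum_b w b * ((row b == row a) && (col b == col a))%:R) :
  0 <= (\sum_a w a * r a) * (\sum_a w a * c a) + X ^+ 2 * (\sum_a w a * x a)
       - 2%:R * X * \sum_a w a * (r a * c a).
Proof.
pose r' i := \sum_b w b * (row b == i)%:R.
pose c' j := \sum_b w b * (col b == j)%:R.
pose cell a := (row a, col a).
pose x' p := \sum_b w b * (cell b == p)%:R.
have <- : \sum_i r' i * r' i = \sum_a w a * r a by exact: sum_fiber.
have <- : \sum_j c' j * c' j = \sum_a w a * c a by exact: sum_fiber.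
have <- : \sum_p x' p * x' p = \sum_a w a * x a by exact: sum_fiber.
have <- : \sum_p x' p * (r' p.1 * c' p.2) = \sum_a w a * (r a * c a).
  exact: (sum_fiber cell w (fun p => r' p.1 * c' p.2)).
have -> : (\sum_i r' i * r' i) * (\sum_j c' j * c' j)
    = \sum_p (r' p.1 * c' p.2) ^+ 2.
  rewrite mulr_suml -(pair_bigA _ (fun i j => (r' i * c' j) ^+ 2)) /=.
  apply: eq_bigr => i _; rewrite mulr_sumr; apply: eq_bigr => j _.
  by ring.
rewrite [X ^+ 2 * _]mulr_sumr [2%:R * X * _]mulr_sumr -big_split -sumrB; apply: sumr_ge0 => p _ /=.
have -> : (r' p.1 * c' p.2) ^+ 2 + X ^+ 2 * (x' p * x' p)
   - 2%:R * X * (x' p * (r' p.1 * c' p.2)) = (X * x' p - r' p.1 * c' p.2) ^+ 2.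
  by ring.
exact: sqr_ge0.
Qed.

(** With equal weights, a bound on kernels that may fail for one order of a triple can be proved for
    the sum over its six orders. *)
Lemma form3_sym (R : comNzRingType) (E : finType) (k : E -> E -> E -> R)
    (w : E -> R) :
  form3 (fun a b c => k a b c + k a c b + k b a c + k b c a + k c a b + k c b a)
    w w w = 6%:R * form3 k w w w.
Proof.
have e132 k' : form3 (fun a b c => k' a c b) w w w = form3 k' w w w.
  exact: form3_swap23.
have e213 k' : form3 (fun a b c => k' b a c) w w w = form3 k' w w w.
  exact: form3_swap12.
rewrite !form3D e132 e213 (e213 (fun a b c => k a c b)) e132.
rewrite (e132 (fun a b c => k b a c)) e213.
rewrite (e213 (fun a b c => k c a b)) (e132 (fun a b c => k b a c)) e213.
by ring.
Qed.

(** * Parallel classes in the contraction by a point *)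

(** Transitivity of parallelism in the contraction by [e], where [x] witnesses that [b] is no loop:
    exchange [x] against [{e, a, c}]. *)
Lemma basis3_cotrans (E : finType) (M : matroid E) e x a b c :
  rank M = 3%N -> basis3 M e x b -> basis3 M e a c ->
  basis3 M e a b || basis3 M e b c.
Proof.
move=> rk; rewrite basis3C12 => Kxeb Keac.
have := basis3_exchange rk Kxeb Keac.
by rewrite basis3_diag // (basis3C12 M a) (basis3C12 M c) (basis3C23 M e c).
Qed.

(* In the rank-two contraction by [c], the pairs [{e, f}] and [{a, b}] are both
   bases, hence one of the two perfect matchings between them consists of
   bases. *)
Lemma basis3_matching (E : finType) (M : matroid E) e f a b c :
  rank M = 3%N -> basis3 M e f c -> basis3 M a b c ->
  basis3 M e a c && basis3 M f b c || basis3 M e b c && basis3 M f a c.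
Proof.
move=> rk Kefc Kabc.
have Kfec : basis3 M f e c by rewrite basis3C12.
have Kbac : basis3 M b a c by rewrite basis3C12.
(* Each of the four points gets a partner in the opposite pair, which already forces a perfect
   matching. *)
have := basis3_exchange rk Kabc Kefc; have := basis3_exchange rk Kbac Kefc.
have := basis3_exchange rk Kefc Kabc; have := basis3_exchange rk Kfec Kabc.
rewrite !(basis3C12 M a) !(basis3C12 M b) !basis3_diag13 // !orbF.
by do 4!case: (basis3 M _ _ _).
Qed.

(** A basis cannot lie inside the line [ef]: exchanging [w] against it yields a point off that
    line. *)
Lemma basis3_span (E : finType) (M : matroid E) e f w a b c :
  rank M = 3%N -> basis3 M e f w -> basis3 M a b c ->
  [|| basis3 M e f a, basis3 M e f b | basis3 M e f c].
Proof.
move=> rk; rewrite basis3C23 basis3C12 => Kwef /(basis3_exchange rk Kwef).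
by rewrite !(basis3C12 M _ e) !(basis3C23 M e _ f).
Qed.

(** In the contraction by [e], [a] is a loop or parallel to [f], while [p] and [q] are not parallel
    to [f]; both sides say that [a] is no loop there. *)
Lemma basis3_line (E : finType) (M : matroid E) e f p q a :
  rank M = 3%N -> basis3 M e f p -> basis3 M e f q -> ~~ basis3 M e f a ->
  basis3 M e a p = basis3 M e a q.
Proof.
move=> rk Kp Kq /negPf nKa; apply/idP/idP; rewrite basis3C23 => Ka.
  by have := basis3_cotrans rk Ka Kq; rewrite nKa.
by have := basis3_cotrans rk Ka Kp; rewrite nKa.
Qed.

(** For [a] off the line [ef], this is the line [ea] without its points on [ef]: a parallel class of
    the contraction by [e], used as the label of a row or column. *)
Definition contract_line (E : finType) (M : matroid E) (e f a : E) : {set E} :=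
  [set b | basis3 M e f b && ~~ basis3 M e a b].

Lemma contract_lineP (E : finType) (M : matroid E) e f a b :
  rank M = 3%N -> basis3 M e f a -> basis3 M e f b ->
  (contract_line M e f a == contract_line M e f b) = ~~ basis3 M e a b.
Proof.
move=> rk Kefa Kefb; apply/eqP/idP => [lab | nKeab].
  have : b \in contract_line M e f b by rewrite inE Kefb basis3_diag23.
  by rewrite -lab inE => /andP[].
apply/setP => c; rewrite !inE; congr (_ && ~~ _); apply/idP/idP => Kc.
  by have := basis3_cotrans rk Kefb Kc; rewrite (negPf nKeab).
by have := basis3_cotrans rk Kefa Kc; rewrite basis3C23 (negPf nKeab).
Qed.

(** * The inequality off the line *)

(* The two [form2] terms are [2 R] and [2 C], the [form3] term is [6 T]. *)
Lemma off_line_ineq (R : realFieldType) (E : finType) (M : matroid E) e f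
    (w : E -> R) :
  rank M = 3%N -> (forall a, 0 <= w a) -> (forall a, w a != 0 -> basis3 M e f a) ->
  2%:R * (\sum_a w a) * form3 (fun a b c => (basis3 M a b c)%:R) w w w
  <= 3%:R * form2 (fun a b => (basis3 M e a b)%:R) w w
     * form2 (fun a b => (basis3 M f a b)%:R) w w.
Proof.
move=> rk w0 wK.
have wK' a : w a != 0 -> basis3 M f e a by rewrite basis3C12; exact: wK.
pose row := contract_line M e f; pose col := contract_line M f e.
have := grid_ineq row col w; cbv beta zeta.
set X := \sum_a w a.
set A := \sum_a _; set B := \sum_a _; set S := \sum_a _; set Q := \sum_a _.
(* All pairs minus those in a common class, so [2 R = X^2 - A] and [2 C = X^2 - B]. *)
have form2E (l : E -> {set E}) (k : E -> E -> bool) :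
    (forall a b, w a != 0 -> w b != 0 -> (l b == l a) = ~~ k a b) ->
  form2 (fun a b => (k a b)%:R) w w
  = X ^+ 2 - \sum_a w a * \sum_b w b * (l b == l a)%:R.
  move=> lk; rewrite expr2 {1}/X mulr_suml -sumrB; apply: eq_bigr => a _.
  rewrite -mulrBr -sumrB mulr_sumr; apply: eq_bigr => b _.
  have [->|wa] := eqVneq (w a) 0; first by rewrite !mul0r.
  have [->|wb] := eqVneq (w b) 0; first by rewrite !(mulr0, mul0r) subrr mulr0.
  by rewrite lk //; case: (k a b) => /=; ring.
rewrite (form2E row (basis3 M e)); last first.
  by move=> a b wa wb; rewrite eq_sym contract_lineP //; exact: wK.
rewrite (form2E col (basis3 M f)); last first.
  by move=> a b wa wb; rewrite eq_sym contract_lineP //; exact: wK'.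
rewrite -/A -/B.
pose rho a b := (row b == row a)%:R : R.
pose kap a b := (col b == col a)%:R : R.
pose del a b := ((row b == row a) && (col b == col a))%:R : R.
(* Chosen so that [X] times its form is [(X^2 - A) (X^2 - B)] with [A B] replaced by its lower bound
   [2 X Q - X^2 S] from the grid inequality. *)
pose k a b c := 1 - rho a b - kap a b - del a b + 2%:R * (rho a b * kap a c).
have kE : form3 k w w w = X ^+ 3 - X * A - X * B - X * S + 2%:R * Q.
  have -> : X ^+ 3 = X * \sum_a w a * X by rewrite -mulr_suml -/X; ring.
  rewrite -!mulrBr -!sumrB mulr_sumr [2%:R * Q]mulr_sumr -big_split.
  apply: eq_bigr => a _ /=.
  set r := \sum_b w b * (row b == _)%:R; set c := \sum_b w b * (col b == _)%:R.
  set x := \sum_b w b * (_ && _)%:R.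
  have -> : X * (w a * X - w a * r - w a * c - w a * x) + 2%:R * (w a * (r * c))
      = w a * (X * (X - r - c - x) + 2%:R * (r * c)) by ring.
  transitivity (w a * \sum_b w b * (X * (1 - rho a b - kap a b - del a b)
       + 2%:R * rho a b * c)).
    rewrite mulr_sumr; apply: eq_bigr => b _.
    rewrite /X mulr_suml [_ * c]mulr_sumr -big_split !mulr_sumr.
    by apply: eq_bigr => d _; rewrite /k -/(kap a d) /=; ring.
  have -> : X - r - c - x = \sum_b w b * (1 - rho a b - kap a b - del a b).
    by rewrite -!sumrB; apply: eq_bigr => b _; rewrite !mulrBr mulr1.
  congr (_ * _); rewrite [r * c]mulr_suml !mulr_sumr -big_split.
  by apply: eq_bigr => b _ /=; rewrite -/(rho a b); ring.
(* Summed over the six orders of a triple, [k] gives [2 n + 4 t], where [n] and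
   [t] indicate the triples counted in [N] and in [T']. *)
have key : 4%:R * form3 (fun a b c => (basis3 M a b c)%:R) w w w
    <= 6%:R * form3 k w w w.
  rewrite -form3Z -form3_sym; apply: ler_form3 => // a b c.
  move=> /[dup] /wK ea /wK' fa /[dup] /wK eb /wK' fb /[dup] /wK ec /wK' fc.
  (* For a basis, the matching at each point puts one of the other two in another row and the
     remaining one in another column. [basis3_cotrans] makes sharing a row or column transitive. *)
  have := basis3_matching (a := a) (b := b) rk ec.
  have := basis3_matching (a := a) (b := c) rk eb.
  have := basis3_matching (a := b) (b := c) rk ea.
  rewrite (basis3C23 M a c b) (basis3C23 M b c a) (basis3C12 M b a c).
  have := basis3_cotrans (a := a) (c := c) rk eb.
  have := basis3_cotrans (a := a) (c := c) rk fb.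
  have := basis3_cotrans (a := a) (c := b) rk ec.
  have := basis3_cotrans (a := a) (c := b) rk fc.
  have := basis3_cotrans (a := b) (c := c) rk ea.
  have := basis3_cotrans (a := b) (c := c) rk fa.
  rewrite /k /rho /kap /del /row /col !contract_lineP //.
  rewrite !(basis3C23 M _ b a) !(basis3C23 M _ c a) !(basis3C23 M _ c b).
  case: (basis3 M e a b); case: (basis3 M e a c); case: (basis3 M e b c);
  case: (basis3 M f a b); case: (basis3 M f a c); case: (basis3 M f b c);
  case: (basis3 M a b c) => //=; do 20?[move=> /(_ isT) // | move=> _];
  lra.
have X0 : 0 <= X by exact: sumr_ge0.
move: key; rewrite kE => /(ler_wpM2l X0) key.
(* Twice the goal is [key] plus six times [grid]. *)
move=> grid; nra.
Qed.

(** * Contribution of the points on the line *)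

(** Two points on the line [ef] never complete [e] to a basis; for one on it and one off it, the
    latter may be replaced by [p]. *)
Lemma form2_line_split (R : comNzRingType) (E : finType) (M : matroid E)
    (e f p : E) (u v : E -> R) :
  rank M = 3%N -> basis3 M e f p ->
  (forall a, u a != 0 -> ~~ basis3 M e f a) ->
  (forall a, v a != 0 -> basis3 M e f a) ->
  form2 (fun a b => (basis3 M e a b)%:R) (u \+ v) (u \+ v)
  = 2%:R * ((\sum_a u a * (basis3 M e a p)%:R) * \sum_a v a)
    + form2 (fun a b => (basis3 M e a b)%:R) v v.
Proof.
move=> rk Kefp uL vW; rewrite form2_split => [|a b]; last by rewrite basis3C23.
rewrite [X in X + _ + _]big1 ?add0r => [|a _]; last first.
  apply: big1 => b _.
  have [->|ua] := eqVneq (u a) 0; first by rewrite !mul0r.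
  have [->|ub] := eqVneq (u b) 0; first by rewrite mulr0 mul0r.
  have [Keab|] := boolP (basis3 M e a b); last by rewrite mulr0.
  have := basis3_span rk Kefp Keab.
  by rewrite basis3_diag13 // (negPf (uL a ua)) (negPf (uL b ub)).
congr (_ * _ + _); rewrite mulr_suml; apply: eq_bigr => a _.
rewrite mulr_sumr; apply: eq_bigr => b _.
have [->|ua] := eqVneq (u a) 0; first by rewrite !mul0r.
have [->|vb] := eqVneq (v b) 0; first by rewrite !mulr0 mul0r.
rewrite (basis3_line rk (vW b vb) Kefp) //; first by ring.
exact: uL.
Qed.

Lemma link_poly_ge0 (R : realFieldType) (E : finType) (M : matroid E)
    (I : {set E}) (y : E -> R) :
  (forall c, 0 <= y c) -> 0 <= link_poly M I y.
Proof. by move=> y0; apply: sumr_ge0 => B _; apply: prodr_ge0. Qed.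

(** Both sides are compared by degree in the weights [u] of the points on the line: degree three
    vanishes, degrees two and one are [uuv] and [uvv], degree zero is [off_line_ineq]. *)
Lemma link_poly_rayleigh (R : realFieldType) (E : finType) (M : matroid E)
    (e f : E) (z : E -> R) :
  rank M = 3%N -> e != f -> (forall c, 0 <= z c) ->
  link_poly M [set e; f] z * link_poly M set0 z
  <= link_poly M [set e] z * link_poly M [set f] z.
Proof.
move=> rk ef z0.
pose u a := if basis3 M e f a then 0 else z a.
pose v a := if basis3 M e f a then z a else 0.
have uL a : u a != 0 -> ~~ basis3 M e f a by rewrite /u; case: ifP; rewrite ?eqxx.
have vW a : v a != 0 -> basis3 M e f a by rewrite /v; case: ifP; rewrite ?eqxx.
have u0 a : 0 <= u a by rewrite /u; case: ifP.
have v0 a : 0 <= v a by rewrite /v; case: ifP.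
have zE : z =1 u \+ v by move=> a; rewrite /u /v /=; case: ifP; rewrite ?addr0 ?add0r.
have linkE I : link_poly M I z = link_poly M I (u \+ v).
  by apply: eq_bigr => B _; apply: eq_bigr => c _; exact: zE.
have XE : link_poly M [set e; f] z = \sum_a v a.
  rewrite link_poly2 //; apply: eq_bigr => a _; rewrite /v.
  by case: ifP; rewrite ?mulr1 ?mulr0.
have [p Kefp|none] := pickP (basis3 M e f); last first.
  rewrite XE big1 => [|a _]; last by rewrite /v none.
  by rewrite mul0r mulr_ge0 ?link_poly_ge0.
have Kfep : basis3 M f e p by rewrite basis3C12.
have uL' a : u a != 0 -> ~~ basis3 M f e a by rewrite basis3C12; exact: uL.
have vW' a : v a != 0 -> basis3 M f e a by rewrite basis3C12; exact: vW.
have {XE} := XE; rewrite !linkE => XE.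
have := link_poly1 e (u \+ v) rk; rewrite (form2_line_split rk Kefp) //.
have := link_poly1 f (u \+ v) rk; rewrite (form2_line_split rk Kfep) //.
have := link_poly0 (u \+ v) rk.
rewrite form3_split; last 2 first.
- by move=> a b c; rewrite basis3C12.
- by move=> a b c; rewrite basis3C23.
rewrite [form3 _ u u u]big1 ?add0r => [|a _]; last first.
  apply: big1 => b _; apply: big1 => c _.
  have [->|ua] := eqVneq (u a) 0; first by rewrite !mul0r.
  have [->|ub] := eqVneq (u b) 0; first by rewrite mulr0 !mul0r.
  have [->|uc] := eqVneq (u c) 0; first by rewrite mulr0 mul0r.
  have [Kabc|] := boolP (basis3 M a b c); last by rewrite mulr0.
  have := basis3_span rk Kefp Kabc.
  by rewrite (negPf (uL a ua)) (negPf (uL b ub)) (negPf (uL c uc)).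
set bas := fun a b c => (basis3 M a b c)%:R.
have := off_line_ineq rk v0 vW.
pose be a : R := (basis3 M e a p)%:R; pose bf a : R := (basis3 M f a p)%:R.
(* The matching at [c] makes one of [a], [b] independent of [e] and the other of [f]; [p] may
   replace [c] here. *)
have uuv : form3 bas u u v <= 2%:R * (\sum_a u a * be a) * (\sum_a u a * bf a)
    * \sum_a v a.
  have -> : 2%:R * (\sum_a u a * be a) * (\sum_a u a * bf a) * (\sum_a v a)
      = form3 (fun a b c => be a * bf b + bf a * be b) u u v.
    by rewrite form3D !form3_sep; ring.
  apply: ler_form3 => // a b c ua ub vc.
  have := basis3_matching (a := a) (b := b) rk (vW _ vc).
  rewrite !(basis3_line rk (vW _ vc) Kefp) ?uL //.
  rewrite !(basis3_line rk (vW' _ vc) Kfep) ?uL' // /bas /be /bf.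
  case: (basis3 M a b c) => [/(_ isT)|_];
    last by rewrite addr_ge0 ?mulr_ge0 ?ler0n.
  by case/orP=> /andP[-> ->]; rewrite mulr1 ?lerDl ?lerDr mulr_ge0 ?ler0n.
(* The matching at [c] joins the line point [a] to one of [e], [f]; the other one forms a basis with
   [b] and [c]. *)
have uvv : form3 bas u v v
    <= (\sum_a u a * be a) * form2 (fun a b => (basis3 M f a b)%:R) v v
     + (\sum_a u a * bf a) * form2 (fun a b => (basis3 M e a b)%:R) v v.
  rewrite -!form3_sep2 -form3D.
  apply: ler_form3 => // a b c ua vb vc.
  have := basis3_matching (a := a) (b := b) rk (vW _ vc).
  rewrite (basis3_line (a := a) rk (vW _ vc) Kefp) ?uL //.
  rewrite (basis3_line (a := a) rk (vW' _ vc) Kfep) ?uL' // /bas /be /bf.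
  case: (basis3 M a b c) => [/(_ isT)|_];
    last by rewrite addr_ge0 ?mulr_ge0 ?ler0n.
  case/orP=> /andP[-> ->]; rewrite mulr1 ?lerDl ?lerDr mulr_ge0 ?ler0n //.
have X0 : 0 <= \sum_a v a by exact: sumr_ge0.
move: XE X0 uuv uvv; rewrite -/bas -/be -/bf.
move: (\sum_a v a) (\sum_a u a * be a) (\sum_a u a * bf a) => X Pe Pf.
move: (form2 _ v v) (form2 _ v v) (form3 _ v v v) (form3 _ u u v) (form3 _ u v v).
move=> Fe Ff T U V XE X0 leU leV leT eqZ eqf eqe; rewrite XE.
have hU := ler_wpM2l X0 leU; have hV := ler_wpM2l X0 leV.
have -> : link_poly M [set e] (u \+ v) = Pe * X + Fe / 2%:R by lra.
have -> : link_poly M [set f] (u \+ v) = Pf * X + Ff / 2%:R by lra.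
have -> : link_poly M set0 (u \+ v) = (3%:R * U + 3%:R * V + T) / 6%:R by lra.
(* The sum of half of [hU], half of [hV] and a twelfth of [leT]. *)
nra.
Qed.

Theorem theorem1p1 (R : realType) (E : finType) (M : matroid E) :
  rank M = 3%N -> rayleigh R M.
Proof.
move=> rk y y0 e f ef; rewrite /rayleigh_diff subr_ge0.
(* Zero weight at [e] and [f] performs the deletions in all four minors at once; contracted elements
   do not occur in the products. *)
pose z c := if c \in [set e; f] then 0 else y c.
have linkE (I J : {set E}) : [disjoint I & J] -> I :|: J = [set e; f] ->
    minor_poly M I J y = link_poly M I z.
  move=> dIJ IJ; apply: minor_poly_link => // c cIJ.
    by rewrite /z -IJ inE cIJ orbT.
  by rewrite /z -IJ (negPf cIJ).
rewrite (linkE [set e; f] set0) ?(linkE set0) -?setI_eq0 ?setI0 ?set0I ?setU0 ?set0U //.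
rewrite (linkE [set e] [set f]) ?disjoints1 ?inE //.
rewrite (linkE [set f] [set e]) ?disjoints1 ?inE 1?eq_sym //; last exact: setUC.
apply: link_poly_rayleigh => // c; rewrite /z.
by case: ifP => // _; exact: ltW.
Qed.
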